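(* (i) Let $p,q\in(0,\infty)$. The double inequality $$1-\frac{1}{2p^2}+\frac{1}{2p^2}\cosh pt<I_0(t)<1-\frac{1}{2q^2}+\frac{1}{2q^2}\cosh qt$$ holds for all $t>0$ if and only if $p\in(0,\sqrt3/2]$ and $q\in[1,\infty)$. (ii) For $p\in(\sqrt3/2,1)$, the inequality $$I_0(t)\ge 1-\frac{\lambda_0}{p^2}+\frac{\lambda_0}{p^2}\cosh pt$$ holds for all $t>0$, with $$\lambda_0=\frac{I_0(t_0)-1}{(\cosh pt_0-1)/p^2},$$ where $t_0$ is the unique solution on $(0,\infty)$ of the equation $$\frac{d}{dt}\,\frac{I_0(t)-1}{\cosh pt-1}=0.$$
   Context: $I_0(t)=\sum_{n=0}^{\infty}\frac{t^{2n}}{2^{2n}(n!)^2}$ denotes the modified Bessel function of the first kind of order $0$. *)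

(* Defs.v *)
From Stdlib Require Import Reals Factorial.
From Coquelicot Require Import Coquelicot.
Open Scope R_scope.

Definition BesselI0 (t : R) : R :=
  Series (fun n : nat => t ^ (2 * n) / (2 ^ (2 * n) * (INR (fact n)) ^ 2)).

Definition bessel_cosh_ratio (p t : R) : R :=
  (BesselI0 t - 1) / (cosh (p * t) - 1).

Definition lambda0 (p t0 : R) : R :=
  (BesselI0 t0 - 1) / ((cosh (p * t0) - 1) / p ^ 2).

(* Main.v *)
Require Import Defs.
From Stdlib Require Import Reals Factorial Arith Classical Lra Lia.
From Coquelicot Require Import Coquelicot.
Open Scope R_scope.

(** Put [x = t ^ 2].  For every constant [lam],
    [I0 t - 1 - lam * (cosh (p t) - 1)] is a power series in [x] with
    coefficients [w_n * (r_n - lam)], where [w_n >= 0] are the coefficients of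
    [cosh (p t) - 1] and [r_n = C(2n,n) / (4 p^2)^n] is the ratio of the
    coefficients of the two functions.  Consecutive ratios satisfy
    [r_(n+1) / r_n = (2n+1) / ((2n+2) p^2)], a quantity that increases with [n]
    from [3/(4 p^2)] at [n = 1] to [1/p^2].  So from [n = 1] on the sequence
    [r_n] is nondecreasing if [4 p^2 <= 3], decreases if [p >= 1], and otherwise
    falls, then rises to infinity ([coef_ratio_rises_forever],
    [coef_ratio_fell_before], [coef_ratio_unbounded]).

    Both inequalities of the first part compare
    [h t = (I0 t - 1) / (cosh (p t) - 1)] with its limit [r_1 = 1 / (2 p^2)] at
    [0].  When [r] is monotone, they hold coefficient by coefficient.  When
    [4 p^2 > 3] the first nonzero coefficient of the series for [lam = r_1] is
    negative, so the lower bound fails near [0]; when the parameter is below [1]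
    the coefficients are eventually positive, so the upper bound fails near
    infinity.

    For the second part, a critical point [s] of [h] makes [s ^ 2] a double zero
    of the series for [lam = h s].  The signs of its coefficients are [+ - +].
    A power series with this sign pattern and a double zero is positive
    at every other positive point ([PSeries_pos_of_double_zero]): [h > h s] away
    from [s], so any critical point is the unique strict global minimum.  A
    critical point exists because [h] starts near [r_1], goes below it, and tends
    to infinity. *)

(** * Positivity of power series from the signs of their coefficients *)

Lemma pow_ge_tangent (z : R) (n : nat) :
  0 < z -> 1 + INR n * (z - 1) <= z ^ n.
Proof.
  intros Hz. induction n as [|n IH].
  - simpl; lra.
  - rewrite S_INR. simpl.
    assert (0 <= INR n * ((z - 1) * (z - 1)))
      by (apply Rmult_le_pos; [apply pos_INR|apply Rle_0_sqr]).
    apply Rle_trans with (z * (1 + INR n * (z - 1))); [lra|].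
    apply Rmult_le_compat_l; lra.
Qed.

(** Strict convexity of [n |-> y ^ n] on the integers.  After division by
    [y ^ i], with [a = j - i] and [b = k - j], Bernoulli's inequality applied to
    [y ^ b] and to [(/ y) ^ a] leaves the gap [a b y^(a-1) (y-1)^2]. *)
Lemma pow_lt_chord (y : R) (i j k : nat) :
  0 < y -> y <> 1 -> (i < j)%nat -> (j < k)%nat ->
  (INR k - INR i) * y ^ j < (INR k - INR j) * y ^ i + (INR j - INR i) * y ^ k.
Proof.
  intros Hy Hy1 Hij Hjk.
  destruct (Nat.le_exists_sub (S i) j Hij) as [m [-> _]].
  destruct (Nat.le_exists_sub _ _ Hjk) as [l [-> _]].
  replace (m + S i)%nat with (i + S m)%nat by lia.
  replace (l + S (i + S m))%nat with (i + (S m + S l))%nat by lia.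
  rewrite !plus_INR, !pow_add.
  assert (Hi : 0 < y ^ i) by now apply pow_lt.
  assert (Hm : 0 < y ^ m) by now apply pow_lt.
  assert (Ha : 0 < INR (S m)) by (apply lt_0_INR; lia).
  assert (Hb : 0 < INR (S l)) by (apply lt_0_INR; lia).
  (* Two tangent lines: at exponent [S l] for [y], at exponent [S m] for [/ y]. *)
  pose proof (pow_ge_tangent y (S l) Hy) as Hup.
  assert (Hdown : 1 + INR (S m) * (/ y - 1) <= / y ^ S m).
  { rewrite <- pow_inv. apply pow_ge_tangent. now apply Rinv_0_lt_compat. }
  set (a := INR (S m)) in *. set (b := INR (S l)) in *. set (Y := y ^ S l) in *.
  assert (Hdown' : y ^ S m + a * y ^ m * (1 - y) <= 1).
  { assert (Hp : 0 < y ^ S m) by now apply pow_lt.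
    apply Rmult_le_compat_l with (r := y ^ S m) in Hdown; [|lra].
    rewrite Rinv_r in Hdown by lra.
    replace (y ^ S m * (1 + a * (/ y - 1)))
      with (y ^ S m + a * y ^ m * (1 - y)) in Hdown by (simpl; field; lra).
    exact Hdown. }
  simpl (y ^ S m) in *.
  assert (Hgap : 0 < y ^ m * (a * b * ((y - 1) * (y - 1)))).
  { apply Rmult_lt_0_compat; [easy|].
    apply Rmult_lt_0_compat; [now apply Rmult_lt_0_compat|].
    assert (y - 1 <> 0) by lra. now apply Rsqr_pos_lt. }
  assert (H1 : a * (y * y ^ m) * (1 + b * (y - 1)) <= a * (y * y ^ m) * Y).
  { apply Rmult_le_compat_l; [|easy].
    apply Rmult_le_pos; [lra|]. apply Rmult_le_pos; lra. }
  assert (H2 : b * (y * y ^ m + a * y ^ m * (1 - y)) <= b * 1)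
    by (apply Rmult_le_compat_l; lra).
  apply Rlt_0_minus.
  replace (_ - _) with
    (y ^ i * (b + a * (y * y ^ m) * Y - (a + b) * (y * y ^ m))) by ring.
  apply Rmult_lt_0_compat; [easy|]. nra.
Qed.

Lemma is_series_pos (a : nat -> R) (l : R) (m : nat) :
  is_series a l -> (forall n, 0 <= a n) -> 0 < a m -> 0 < l.
Proof.
  intros Ha Hpos Hm.
  rewrite <- (is_series_unique _ _ Ha).
  assert (Hex : ex_series a) by now exists l.
  rewrite (Series_incr_n a (S m)); [|lia|easy].
  assert (Htail : 0 <= Series (fun k => a (S m + k)%nat)).
  { rewrite <- (Rmult_0_l (Series (fun _ => 0))), <- Series_scal_l.
    apply Series_le.
    - intros n; split; [lra|]. rewrite Rmult_0_l. apply Hpos.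
    - now apply (ex_series_incr_n a (S m)). }
  assert (Hhead : 0 < sum_f_R0 a (pred (S m))).
  { simpl. destruct m as [|m]; [easy|]. simpl.
    pose proof (cond_pos_sum a m Hpos). lra. }
  lra.
Qed.

Lemma PSeries_pos (c : nat -> R) (x : R) (m : nat) :
  ex_pseries c x -> (forall n, 0 <= c n) -> 0 < c m -> 0 < x -> 0 < PSeries c x.
Proof.
  intros Hex Hpos Hm Hx.
  apply (is_series_pos (fun n => c n * x ^ n) _ m).
  - now apply is_pseries_R, PSeries_correct.
  - intros n. apply Rmult_le_pos; [easy|]. now apply pow_le, Rlt_le.
  - apply Rmult_lt_0_compat; [easy|]. now apply pow_lt.
Qed.

(** With [y = x / s], the weights [c n * s ^ n] have total mass [0] and first
    moment [0], so [PSeries c x], their integral against [n |-> y ^ n], is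
    unchanged when an affine function of [n] is subtracted.  Subtracting the
    chord of [n |-> y ^ n] through [u] and [v] makes the integrand change sign
    exactly where the weights do, by convexity, so every term is nonnegative and
    the term of index [m] is positive. *)
Lemma PSeries_pos_of_double_zero (c : nat -> R) (u m v : nat) (s x : R) :
  CV_radius c = p_infty ->
  (u < m < v)%nat -> c m < 0 ->
  (forall n, (n <= u)%nat -> 0 <= c n) ->
  (forall n, (u < n < v)%nat -> c n <= 0) ->
  (forall n, (v <= n)%nat -> 0 <= c n) ->
  0 < s -> PSeries c s = 0 -> PSeries (PS_derive c) s = 0 ->
  0 < x -> x <> s -> 0 < PSeries c x.
Proof.
  intros Hcv Hm Hcm Hlow Hmid Hhigh Hs Hf Hf' Hx Hxs.
  set (y := x / s).
  assert (Hy : 0 < y) by now apply Rdiv_lt_0_compat.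
  assert (Hy1 : y <> 1).
  { intros E. apply Hxs. unfold y in E. apply (f_equal (Rmult s)) in E.
    field_simplify in E; lra. }
  assert (Hser : forall z, is_series (fun n => c n * z ^ n) (PSeries c z)).
  { intros z. apply is_pseries_R, PSeries_correct, CV_radius_inside.
    now rewrite Hcv. }
  assert (Hmom : is_series (fun n => INR n * (c n * s ^ n)) 0).
  { assert (Hd : is_pseries (PS_derive c) s 0).
    { rewrite <- Hf'. apply PSeries_correct, CV_radius_inside.
      now rewrite CV_radius_derive, Hcv. }
    apply is_pseries_incr_1, is_pseries_R in Hd.
    replace 0 with (scal s 0) by apply Rmult_0_r.
    apply is_series_ext with (2 := Hd).
    intros [|n]; unfold PS_incr_1, PS_derive; simpl; [|ring].
    unfold zero; simpl; ring. }
  (* [v - u] times the difference between [y ^ n] and its chord. *)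
  set (K := fun n => (INR v - INR u) * y ^ n - (INR v - INR n) * y ^ u
                     - (INR n - INR u) * y ^ v).
  assert (HK : is_series (fun n => c n * s ^ n * K n)
                 ((INR v - INR u) * PSeries c x)).
  { pose proof (is_series_scal (INR v - INR u) _ _ (Hser x)) as H1.
    pose proof (Hser s) as H2. rewrite Hf in H2.
    pose proof (is_series_scal (INR u * y ^ v - INR v * y ^ u) _ _ H2) as H3.
    pose proof (is_series_scal (y ^ u - y ^ v) _ _ Hmom) as H4.
    pose proof (is_series_plus _ _ _ _ (is_series_plus _ _ _ _ H1 H3) H4) as H.
    unfold scal, plus in H; simpl in H; unfold mult in H; simpl in H.
    rewrite !Rmult_0_r, !Rplus_0_r in H.
    apply is_series_ext with (2 := H).
    intros n. unfold K.
    match goal with |- ?a = ?b => change (@eq R a b) end.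
    replace (x ^ n) with (s ^ n * y ^ n); [ring|].
    rewrite <- Rpow_mult_distr. f_equal. unfold y; field; lra. }
  assert (Hsn : forall n, 0 < s ^ n) by (intros; now apply pow_lt).
  assert (Huv : 0 < INR v - INR u) by (apply Rlt_0_minus, lt_INR; lia).
  assert (HKmid : forall n, (u < n < v)%nat -> K n < 0).
  { intros n Hn. unfold K.
    pose proof (pow_lt_chord y u n v Hy Hy1 (proj1 Hn) (proj2 Hn)). lra. }
  assert (Hpos : 0 < (INR v - INR u) * PSeries c x).
  { apply (is_series_pos _ _ m HK).
    - intros n.
      destruct (le_lt_dec n u) as [Hnu|Hnu].
      + apply Rmult_le_pos; [apply Rmult_le_pos; [auto|now apply Rlt_le]|].
        destruct (proj1 (Nat.lt_eq_cases n u) Hnu) as [Hlt| ->]; unfold K; [|lra].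
        assert (Huv' : (u < v)%nat) by lia.
        pose proof (pow_lt_chord y n u v Hy Hy1 Hlt Huv'). lra.
      + destruct (le_lt_dec v n) as [Hvn|Hvn].
        * apply Rmult_le_pos; [apply Rmult_le_pos; [auto|now apply Rlt_le]|].
          destruct (proj1 (Nat.lt_eq_cases v n) Hvn) as [Hlt| <-];
            unfold K; [|lra].
          assert (Huv' : (u < v)%nat) by lia.
          pose proof (pow_lt_chord y u v n Hy Hy1 Huv' Hlt). lra.
        * pose proof (HKmid n (conj Hnu Hvn)).
          pose proof (Hmid n (conj Hnu Hvn)). pose proof (Hsn n).
          assert (0 <= (- c n) * s ^ n) by (apply Rmult_le_pos; lra). nra.
    - pose proof (HKmid m Hm). pose proof (Hsn m).
      assert (0 < (- c m) * s ^ m) by (apply Rmult_lt_0_compat; lra). nra. }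
  apply Rmult_lt_reg_l with (INR v - INR u); [easy|]. lra.
Qed.

Lemma PSeries_pos_near_0 (c : nat -> R) (k : nat) (X : R) :
  CV_radius c = p_infty -> (forall n, (n < k)%nat -> c n = 0) -> 0 < c k ->
  0 < X -> exists x, 0 < x < X /\ 0 < PSeries c x.
Proof.
  intros Hcv Hz Hk HX.
  assert (Hcvk : CV_radius (PS_decr_n c k) = p_infty).
  { clear Hz Hk. induction k as [|k IH]; [easy|].
    rewrite <- IH, <- (CV_radius_decr_1 (PS_decr_n c k)).
    apply CV_radius_ext. intros n. unfold PS_decr_n, PS_decr_1. f_equal. lia. }
  assert (Hcont : continuity_pt (PSeries (PS_decr_n c k)) 0)
    by (apply PSeries_continuity; now rewrite Hcvk).
  destruct (Hcont (c k) Hk) as [d [Hd Hball]].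
  exists (Rmin d X / 2).
  assert (0 < Rmin d X) by now apply Rmin_glb_lt.
  pose proof (Rmin_l d X). pose proof (Rmin_r d X).
  split; [lra|].
  rewrite (PSeries_decr_n_aux c k _ Hz).
  apply Rmult_lt_0_compat; [apply pow_lt; lra|].
  specialize (Hball (Rmin d X / 2)).
  simpl in Hball. unfold Rdist in Hball.
  assert (Hlt : Rabs (PSeries (PS_decr_n c k) (Rmin d X / 2)
                      - PSeries (PS_decr_n c k) 0) < c k).
  { apply Hball. split; [split; [exact I|lra]|].
    rewrite Rabs_pos_eq; lra. }
  rewrite PSeries_0 in Hlt. unfold PS_decr_n at 2 in Hlt.
  rewrite Nat.add_0_r in Hlt. apply Rabs_def2 in Hlt. lra.
Qed.

(** The induction needs a uniform positive lower bound [k], not mere positivity: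
    from [c 0 + x * f x] with [f x >= k], a large [x] restores [k] whatever the
    sign of [c 0]. *)
Lemma PSeries_pos_at_infinity (c : nat -> R) (N : nat) :
  CV_radius c = p_infty -> (forall n, (N <= n)%nat -> 0 < c n) ->
  exists X, 0 < X /\ forall x, X <= x -> 0 < PSeries c x.
Proof.
  intros Hcv Hpos.
  cut (exists k X, 0 < k /\ 0 < X /\ forall x, X <= x -> k <= PSeries c x).
  { intros (k & X & Hk & HX & H). exists X. split; [easy|].
    intros x Hx. specialize (H x Hx). lra. }
  revert c Hcv Hpos. induction N as [|N IH]; intros c Hcv Hpos.
  all: assert (Hcv1 : CV_radius (PS_decr_1 c) = p_infty)
         by now rewrite CV_radius_decr_1.
  all: assert (Hdecr : forall x,
         PSeries c x = c O + x * PSeries (PS_decr_1 c) x)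
         by (intros x; apply PSeries_decr_1, CV_radius_inside; now rewrite Hcv).
  - exists (c O), 1. split; [apply Hpos; lia|split; [lra|]]. intros x Hx.
    rewrite Hdecr.
    assert (0 < PSeries (PS_decr_1 c) x); [|nra].
    apply (PSeries_pos _ _ O); [apply CV_radius_inside; now rewrite Hcv1| | |lra].
    + intros n. apply Rlt_le, Hpos; lia.
    + apply Hpos; lia.
  - destruct (IH (PS_decr_1 c) Hcv1) as (k & X & Hk & HX & H).
    { intros n Hn. apply Hpos. lia. }
    exists k, (X + 1 + Rabs (c O) / k).
    assert (Hq : 0 <= Rabs (c O) / k)
      by (apply Rdiv_le_0_compat; [apply Rabs_pos|easy]).
    split; [easy|split; [lra|]]. intros x Hx. rewrite Hdecr.
    assert (Hk' : k <= PSeries (PS_decr_1 c) x) by (apply H; lra).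
    assert (H1 : (1 + Rabs (c O) / k) * k <= x * PSeries (PS_decr_1 c) x)
      by (apply Rmult_le_compat; lra).
    replace ((1 + Rabs (c O) / k) * k) with (k + Rabs (c O)) in H1
      by (field; lra).
    pose proof (Rle_abs (- c O)) as Habs. rewrite Rabs_Ropp in Habs. lra.
Qed.

(** Comparison with the series of [C * exp (K * x)]: its terms are bounded for
    every [x]. *)
Lemma CV_radius_infinite_of_factorial_bound (c : nat -> R) (C K : R) :
  0 <= C -> 0 <= K -> (forall n, Rabs (c n) <= C * K ^ n / INR (fact n)) ->
  CV_radius c = p_infty.
Proof.
  intros HC HK Hc.
  destruct (CV_radius_bounded c) as [Hub _].
  assert (Hr : forall r, Rbar_le (Rabs r) (CV_radius c)).
  { intros r. apply Hub. exists (C * exp (K * Rabs r)). intros n.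
    rewrite Rabs_mult, <- RPow_abs, Rabs_Rabsolu.
    pose proof (Rabs_pos r) as Hr.
    assert (Hx : 0 <= K * Rabs r) by now apply Rmult_le_pos.
    apply Rle_trans with (C * ((K * Rabs r) ^ n / INR (fact n))).
    - apply Rle_trans with (C * K ^ n / INR (fact n) * Rabs r ^ n).
      + apply Rmult_le_compat_r; [now apply pow_le|apply Hc].
      + rewrite Rpow_mult_distr. apply Req_le. field. apply INR_fact_neq_0.
    - apply Rmult_le_compat_l; [easy|].
      eapply Rle_trans; [|now apply (exp_ge_taylor _ n)].
      assert (Hterm : forall k, 0 <= (K * Rabs r) ^ k / INR (fact k)).
      { intros k. apply Rdiv_le_0_compat; [now apply pow_le|apply INR_fact_lt_0]. }
      destruct n as [|n]; [simpl; lra|]. rewrite tech5.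
      pose proof (cond_pos_sum _ n Hterm). lra. }
  destruct (CV_radius c) as [l| |]; [|easy|].
  - specialize (Hr (Rabs l + 1)). simpl in Hr.
    rewrite Rabs_pos_eq in Hr by (pose proof (Rabs_pos l); lra).
    pose proof (Rle_abs l). lra.
  - destruct (Hr 0).
Qed.

(** * The coefficients of the two series and their ratio *)

(** These are the coefficients of [I0 t - 1] in powers of [t ^ 2]. *)
Definition bessel_coef (n : nat) : R :=
  match n with
  | O => 0
  | S _ => 1 / (2 ^ (2 * n) * INR (fact n) ^ 2)
  end.

(** These are the coefficients of [cosh (p * t) - 1] in powers of [t ^ 2]. *)
Definition cosh_coef (p : R) (n : nat) : R :=
  match n with
  | O => 0
  | S _ => p ^ (2 * n) / INR (fact (2 * n))
  end.

(** This is [C(2n,n) / (4 p^2)^n].  At [n = 0], where both coefficients above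
    vanish, it has the value [1], for which the recurrence
    [coef_ratio_succ] still holds. *)
Definition coef_ratio (p : R) (n : nat) : R :=
  INR (fact (2 * n)) / ((2 * p) ^ (2 * n) * INR (fact n) ^ 2).

(** The coefficients of [I0 t - 1 - lam * (cosh (p t) - 1)], whose sign decides
    on which side of [lam] the ratio [bessel_cosh_ratio p t] lies. *)
Definition excess (p lam : R) (n : nat) : R :=
  bessel_coef n - lam * cosh_coef p n.

Lemma cosh_coef_pos (p : R) (n : nat) : 0 < p -> 0 < cosh_coef p (S n).
Proof.
  intros Hp. apply Rdiv_lt_0_compat; [now apply pow_lt|apply INR_fact_lt_0].
Qed.

Lemma cosh_coef_nonneg (p : R) (n : nat) : 0 < p -> 0 <= cosh_coef p n.
Proof.
  intros Hp. destruct n as [|n]; [apply Rle_refl|].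
  now apply Rlt_le, cosh_coef_pos.
Qed.

Lemma excess_factor (p lam : R) (n : nat) :
  0 < p -> excess p lam n = cosh_coef p n * (coef_ratio p n - lam).
Proof.
  intros Hp. unfold excess. destruct n as [|n]; [simpl; ring|].
  unfold bessel_coef, cosh_coef, coef_ratio. rewrite Rpow_mult_distr.
  field. repeat split; try apply INR_fact_neq_0; apply pow_nonzero; lra.
Qed.

Lemma coef_ratio_succ (p : R) (n : nat) : 0 < p ->
  coef_ratio p (S n)
  = coef_ratio p n * ((2 * INR n + 1) / ((2 * INR n + 2) * p ^ 2)).
Proof.
  intros Hp. unfold coef_ratio.
  replace (2 * S n)%nat with (S (S (2 * n))) by lia.
  rewrite !fact_simpl, !mult_INR, !S_INR, mult_INR, <- !tech_pow_Rmult.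
  simpl (INR 2). pose proof (pos_INR n).
  field. repeat split; try apply INR_fact_neq_0; try lra.
  apply pow_nonzero; lra.
Qed.

Lemma coef_ratio_pos (p : R) (n : nat) : 0 < p -> 0 < coef_ratio p n.
Proof.
  intros Hp. apply Rdiv_lt_0_compat; [apply INR_fact_lt_0|].
  apply Rmult_lt_0_compat; apply pow_lt; [lra|apply INR_fact_lt_0].
Qed.

Lemma coef_ratio_1 (p : R) : 0 < p -> coef_ratio p 1 = 1 / (2 * p ^ 2).
Proof. intros Hp. unfold coef_ratio. simpl. field. lra. Qed.

Lemma coef_ratio_step (p : R) (n : nat) : 0 < p ->
  exists k, 0 < k /\
    coef_ratio p (S n) - coef_ratio p n
    = k * (2 * INR n + 1 - (2 * INR n + 2) * p ^ 2).
Proof.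
  intros Hp. pose proof (pos_INR n) as Hn.
  exists (coef_ratio p n / ((2 * INR n + 2) * p ^ 2)). split.
  - apply Rdiv_lt_0_compat; [now apply coef_ratio_pos|].
    apply Rmult_lt_0_compat; [lra|now apply pow_lt].
  - rewrite coef_ratio_succ by easy. field. lra.
Qed.

Lemma coef_ratio_le_succ (p : R) (n : nat) : 0 < p ->
  (coef_ratio p n <= coef_ratio p (S n)
   <-> (2 * INR n + 2) * p ^ 2 <= 2 * INR n + 1).
Proof.
  intros Hp. destruct (coef_ratio_step p n Hp) as (k & Hk & E).
  split; intros H; nra.
Qed.

Lemma coef_ratio_ge_succ (p : R) (n : nat) : 0 < p ->
  (coef_ratio p (S n) <= coef_ratio p n
   <-> 2 * INR n + 1 <= (2 * INR n + 2) * p ^ 2).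
Proof.
  intros Hp. destruct (coef_ratio_step p n Hp) as (k & Hk & E).
  split; intros H; nra.
Qed.

(** A rise at [n] means [p^2 <= (2n+1)/(2n+2)], and the right-hand side
    increases with [n]. *)
Lemma coef_ratio_rises_forever (p : R) (n k : nat) : 0 < p ->
  coef_ratio p n <= coef_ratio p (S n) -> (S n <= k)%nat ->
  coef_ratio p (S n) <= coef_ratio p k.
Proof.
  intros Hp Hn Hk.
  apply coef_ratio_le_succ in Hn; [|easy].
  induction Hk as [|k Hk IH]; [lra|].
  apply Rle_trans with (1 := IH), coef_ratio_le_succ; [easy|].
  apply le_INR in Hk. rewrite S_INR in Hk. pose proof (pos_INR n).
  assert (p ^ 2 < 1) by nra. nra.
Qed.

(** A rise before [n] would propagate to [n], by
    [coef_ratio_rises_forever]. *)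
Lemma coef_ratio_fell_before (p : R) (k n : nat) : 0 < p ->
  coef_ratio p (S n) < coef_ratio p n -> (k <= n)%nat ->
  coef_ratio p n <= coef_ratio p k.
Proof.
  intros Hp Hn Hk. induction Hk as [|n Hk IH]; [lra|].
  assert (Hprev : coef_ratio p (S n) < coef_ratio p n).
  { apply Rnot_le_lt. intros Hle.
    pose proof (coef_ratio_rises_forever p n (S (S n)) Hp Hle).
    assert (coef_ratio p (S n) <= coef_ratio p (S (S n))) by auto. lra. }
  specialize (IH Hprev). lra.
Qed.

(** This is the bound [C(2n,n) >= 4^n / (n+1)]. *)
Lemma coef_ratio_lower (p : R) (n : nat) : 0 < p ->
  / (INR n + 1) * ((/ p) ^ n * (/ p) ^ n) <= coef_ratio p n.
Proof.
  intros Hp. assert (Hip : 0 < / p) by now apply Rinv_0_lt_compat.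
  induction n as [|n IH].
  - unfold coef_ratio. simpl. lra.
  - rewrite coef_ratio_succ, S_INR, <- (tech_pow_Rmult (/ p)) by easy.
    pose proof (pos_INR n) as Hn.
    apply Rle_trans with (/ (INR n + 1) * ((/ p) ^ n * (/ p) ^ n)
                          * ((2 * INR n + 1) / ((2 * INR n + 2) * p ^ 2))).
    + set (z := (/ p) ^ n).
      replace (/ (INR n + 1 + 1) * (/ p * z * (/ p * z)))
        with (z * z * (/ p * / p) * / (INR n + 2)) by (field; lra).
      replace (/ (INR n + 1) * (z * z) * ((2 * INR n + 1) / ((2 * INR n + 2) * p ^ 2)))
        with (z * z * (/ p * / p)
              * ((2 * INR n + 1) / ((INR n + 1) * (2 * INR n + 2)))) by (field; lra).
      apply Rmult_le_compat_l.
      * apply Rmult_le_pos; apply Rlt_le; [|now apply Rmult_lt_0_compat].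
        assert (0 < z) by now apply pow_lt. now apply Rmult_lt_0_compat.
      * apply Rle_div_r; [apply Rmult_lt_0_compat; lra|].
        apply Rmult_le_reg_l with (INR n + 2); [lra|].
        field_simplify; [|lra]. nra.
    + apply Rmult_le_compat_r; [|exact IH].
      apply Rlt_le, Rdiv_lt_0_compat; [lra|].
      apply Rmult_lt_0_compat; [lra|now apply pow_lt].
Qed.

(** Bernoulli's inequality bounds [(1/p)^n] below by [(n+1) d], so the ratio
    is at least [(n+1) d^2]. *)
Lemma coef_ratio_unbounded (p lam : R) : 0 < p < 1 ->
  exists N, forall n, (N <= n)%nat -> lam < coef_ratio p n.
Proof.
  intros [Hp Hp1].
  assert (Hip : 1 < / p) by (rewrite <- Rinv_1; apply Rinv_lt_contravar; lra).
  pose proof (Rmin_l 1 (/ p - 1)) as Hd1. pose proof (Rmin_r 1 (/ p - 1)) as Hd2.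
  (* The minimum with [1] turns [1 + n (1/p - 1)] into a multiple of [n + 1]. *)
  set (d := Rmin 1 (/ p - 1)) in *.
  assert (Hd : 0 < d) by (apply Rmin_glb_lt; lra).
  destruct (INR_unbounded (lam / (d * d))) as [N HN].
  exists N. intros n Hn. apply le_INR in Hn. pose proof (pos_INR n) as Hn0.
  eapply Rlt_le_trans; [|now apply coef_ratio_lower].
  assert (Hz : (INR n + 1) * d <= (/ p) ^ n).
  { eapply Rle_trans; [|apply pow_ge_tangent; lra].
    assert (INR n * d <= INR n * (/ p - 1)) by now apply Rmult_le_compat_l. lra. }
  assert (Hz0 : 0 <= (INR n + 1) * d) by (apply Rmult_le_pos; lra).
  apply Rlt_le_trans with (/ (INR n + 1) * (((INR n + 1) * d) * ((INR n + 1) * d))).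
  - replace (/ (INR n + 1) * ((INR n + 1) * d * ((INR n + 1) * d)))
      with ((INR n + 1) * (d * d)) by (field; lra).
    apply Rlt_div_l; [now apply Rmult_lt_0_compat|]. lra.
  - apply Rmult_le_compat_l; [apply Rlt_le, Rinv_0_lt_compat; lra|].
    now apply Rmult_le_compat.
Qed.

(** * The power series of the two functions *)

Lemma bessel_coef_bound (n : nat) :
  Rabs (bessel_coef n) <= 1 / INR (fact n).
Proof.
  pose proof (INR_fact_lt_0 n) as Hf.
  destruct n as [|n].
  - simpl. rewrite Rabs_R0. lra.
  - unfold bessel_coef.
    assert (H2 : 1 <= 2 ^ (2 * S n)) by (apply pow_R1_Rle; lra).
    assert (H1 : 1 <= INR (fact (S n)))
      by (apply (le_INR 1), lt_O_fact).
    assert (Hle : INR (fact (S n)) <= 2 ^ (2 * S n) * INR (fact (S n)) ^ 2).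
    { assert (1 * INR (fact (S n)) <= INR (fact (S n)) ^ 2) by nra.
      assert (1 * INR (fact (S n)) ^ 2 <= 2 ^ (2 * S n) * INR (fact (S n)) ^ 2)
        by (apply Rmult_le_compat_r; [apply pow2_ge_0|easy]). lra. }
    rewrite Rabs_pos_eq.
    + unfold Rdiv. rewrite !Rmult_1_l. now apply Rinv_le_contravar.
    + apply Rdiv_le_0_compat; lra.
Qed.

Lemma cosh_coef_bound (p : R) (n : nat) : 0 < p ->
  Rabs (cosh_coef p n) <= (p ^ 2) ^ n / INR (fact n).
Proof.
  intros Hp. rewrite Rabs_pos_eq by now apply cosh_coef_nonneg.
  assert (H2 : 0 <= (p ^ 2) ^ n) by apply pow_le, pow2_ge_0.
  destruct n as [|n]; [simpl; lra|].
  unfold cosh_coef. rewrite pow_mult.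
  apply Rmult_le_compat_l; [easy|].
  apply Rinv_le_contravar; [apply INR_fact_lt_0|].
  apply le_INR, fact_le. lia.
Qed.

Lemma CV_radius_excess (p lam : R) : 0 < p -> CV_radius (excess p lam) = p_infty.
Proof.
  intros Hp. assert (Hp2 : 0 < p ^ 2) by now apply pow_lt.
  apply CV_radius_infinite_of_factorial_bound with (1 + Rabs lam) (1 + p ^ 2).
  - pose proof (Rabs_pos lam). lra.
  - lra.
  - intros n. unfold excess, Rminus.
    eapply Rle_trans; [apply Rabs_triang|].
    rewrite Rabs_Ropp, Rabs_mult.
    assert (H1 : 1 / INR (fact n) <= (1 + p ^ 2) ^ n / INR (fact n)).
    { apply Rmult_le_compat_r; [apply Rlt_le, Rinv_0_lt_compat, INR_fact_lt_0|].
      apply pow_R1_Rle. lra. }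
    assert (H2 : (p ^ 2) ^ n / INR (fact n) <= (1 + p ^ 2) ^ n / INR (fact n)).
    { apply Rmult_le_compat_r; [apply Rlt_le, Rinv_0_lt_compat, INR_fact_lt_0|].
      apply pow_incr. lra. }
    assert (H3 : Rabs lam * Rabs (cosh_coef p n)
                 <= Rabs lam * ((1 + p ^ 2) ^ n / INR (fact n))).
    { apply Rmult_le_compat_l; [apply Rabs_pos|].
      eapply Rle_trans; [now apply cosh_coef_bound|easy]. }
    pose proof (bessel_coef_bound n). lra.
Qed.

Lemma CV_radius_bessel_coef : CV_radius bessel_coef = p_infty.
Proof.
  apply CV_radius_infinite_of_factorial_bound with 1 1; [lra|lra|].
  intros n. rewrite pow1, Rmult_1_r. apply bessel_coef_bound.
Qed.

Lemma CV_radius_cosh_coef (p : R) : 0 < p -> CV_radius (cosh_coef p) = p_infty.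
Proof.
  intros Hp.
  apply CV_radius_infinite_of_factorial_bound with 1 (p ^ 2);
    [lra|apply pow2_ge_0|].
  intros n. rewrite Rmult_1_l. now apply cosh_coef_bound.
Qed.

Lemma BesselI0_minus_1 (t : R) : BesselI0 t - 1 = PSeries bessel_coef (t ^ 2).
Proof.
  assert (Hex : ex_series (fun n => bessel_coef n * (t ^ 2) ^ n)).
  { apply ex_pseries_R, CV_radius_inside. now rewrite CV_radius_bessel_coef. }
  unfold BesselI0, PSeries.
  rewrite (Series_incr_1 (fun n => bessel_coef n * (t ^ 2) ^ n)) by easy.
  rewrite Series_incr_1.
  - simpl (bessel_coef 0). rewrite Rmult_0_l, Rplus_0_l.
    simpl (t ^ _ / _). replace (1 / (1 * (1 * (1 * 1)))) with 1 by field.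
    rewrite Rplus_minus_l. apply Series_ext. intros n.
    unfold bessel_coef. rewrite <- pow_mult. unfold Rdiv. rewrite Rmult_1_l.
    apply Rmult_comm.
  - apply (ex_series_incr_1 _). apply ex_series_incr_1 in Hex.
    apply ex_series_ext with (2 := Hex). intros n.
    match goal with |- ?a = ?b => change (@eq R a b) end.
    unfold bessel_coef. rewrite <- pow_mult. unfold Rdiv. rewrite Rmult_1_l.
    apply Rmult_comm.
Qed.

(** The even part of the exponential series. *)
Lemma cosh_even_series (x : R) :
  cosh x = PSeries (fun n => / INR (fact (2 * n))) (x ^ 2).
Proof.
  assert (Hcv : forall i, CV_radius (fun n => / INR (fact (2 * n + i))) = p_infty).
  { intros i. apply CV_radius_infinite_of_factorial_bound with 1 1; [lra|lra|].
    intros n. rewrite pow1, Rmult_1_l. unfold Rdiv. rewrite Rmult_1_l.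
    rewrite Rabs_pos_eq by apply Rlt_le, Rinv_0_lt_compat, INR_fact_lt_0.
    apply Rinv_le_contravar; [apply INR_fact_lt_0|]. apply le_INR, fact_le. lia. }
  assert (He : forall y, ex_pseries (fun n => / INR (fact (2 * n))) y).
  { intros y. apply CV_radius_inside.
    rewrite (CV_radius_ext _ (fun n => / INR (fact (2 * n + 0))));
      [now rewrite Hcv|]. intros n. now rewrite Nat.add_0_r. }
  assert (Ho : forall y, ex_pseries (fun n => / INR (fact (2 * n + 1))) y)
    by (intros y; apply CV_radius_inside; now rewrite Hcv).
  unfold cosh. rewrite !exp_Reals.
  rewrite (PSeries_odd_even _ x) by auto.
  rewrite (PSeries_odd_even _ (- x)) by auto.
  replace ((- x) ^ 2) with (x ^ 2) by ring. field.
Qed.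

Lemma cosh_minus_1 (p t : R) : 0 < p ->
  cosh (p * t) - 1 = PSeries (cosh_coef p) (t ^ 2).
Proof.
  intros Hp.
  assert (Hex : ex_series (fun n => cosh_coef p n * (t ^ 2) ^ n)).
  { apply ex_pseries_R, CV_radius_inside. now rewrite CV_radius_cosh_coef. }
  assert (Hterm : forall n, / INR (fact (2 * S n)) * ((p * t) ^ 2) ^ S n
                            = cosh_coef p (S n) * (t ^ 2) ^ S n).
  { intros n. unfold cosh_coef. rewrite Rpow_mult_distr, Rpow_mult_distr, <- !pow_mult.
    unfold Rdiv. ring. }
  rewrite cosh_even_series. unfold PSeries.
  rewrite (Series_incr_1 (fun n => cosh_coef p n * (t ^ 2) ^ n)) by easy.
  rewrite Series_incr_1.
  - simpl (cosh_coef p 0). rewrite Rmult_0_l, Rplus_0_l.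
    rewrite (Series_ext _ _ Hterm). simpl (fact _). simpl (INR 1).
    rewrite pow_O. field.
  - apply ex_series_incr_1. apply ex_series_incr_1 in Hex.
    apply ex_series_ext with (2 := Hex). intros n. symmetry. apply Hterm.
Qed.

Lemma PSeries_excess (p lam x : R) : 0 < p ->
  PSeries (excess p lam) x
  = PSeries bessel_coef x - lam * PSeries (cosh_coef p) x.
Proof.
  intros Hp. rewrite <- PSeries_scal, <- PSeries_minus.
  - reflexivity.
  - apply CV_radius_inside. now rewrite CV_radius_bessel_coef.
  - apply ex_pseries_scal; [apply Rmult_comm|].
    apply CV_radius_inside. now rewrite CV_radius_cosh_coef.
Qed.

Lemma PSeries_excess_sq (p lam t : R) : 0 < p ->
  PSeries (excess p lam) (t ^ 2)
  = BesselI0 t - 1 - lam * (cosh (p * t) - 1).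
Proof.
  intros Hp. rewrite PSeries_excess, BesselI0_minus_1, cosh_minus_1; auto.
Qed.

(** * Signs of the coefficients of the excess *)

Lemma excess_0 (p lam : R) : excess p lam 0 = 0.
Proof. unfold excess. simpl. ring. Qed.

Lemma excess_pos_iff (p lam : R) (n : nat) : 0 < p ->
  (0 < excess p lam (S n) <-> lam < coef_ratio p (S n)).
Proof.
  intros Hp. rewrite excess_factor by easy.
  pose proof (cosh_coef_pos p n Hp). split; intros H'; nra.
Qed.

Lemma excess_neg_iff (p lam : R) (n : nat) : 0 < p ->
  (excess p lam (S n) < 0 <-> coef_ratio p (S n) < lam).
Proof.
  intros Hp. rewrite excess_factor by easy.
  pose proof (cosh_coef_pos p n Hp). split; intros H'; nra.
Qed.

Lemma excess_nonneg (p lam : R) (n : nat) : 0 < p ->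
  lam <= coef_ratio p n -> 0 <= excess p lam n.
Proof.
  intros Hp H. rewrite excess_factor by easy.
  apply Rmult_le_pos; [now apply cosh_coef_nonneg|lra].
Qed.

Lemma excess_eventually_pos (p lam : R) : 0 < p < 1 ->
  exists N, forall n, (N <= n)%nat -> 0 < excess p lam n.
Proof.
  intros Hp. destruct (coef_ratio_unbounded p lam Hp) as [N HN].
  exists (S N). intros [|n] Hn; [lia|].
  apply excess_pos_iff; [easy|]. apply HN. lia.
Qed.

Lemma last_nonneg_before (c : nat -> R) (m : nat) :
  0 <= c O -> c m < 0 ->
  exists u, (u < m)%nat /\ 0 <= c u /\ forall n, (u < n <= m)%nat -> c n < 0.
Proof.
  intros H0. induction m as [|m IH]; intros Hm; [lra|].
  destruct (Rlt_le_dec (c m) 0) as [Hc|Hc].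
  - destruct (IH Hc) as (u & Hu & Hcu & H). exists u.
    split; [lia|split; [easy|]]. intros n Hn.
    destruct (Nat.eq_dec n (S m)) as [->|]; [easy|]. apply H. lia.
  - exists m. split; [lia|split; [easy|]]. intros n Hn.
    now replace n with (S m) by lia.
Qed.

Lemma first_nonneg_after (c : nat -> R) (m d : nat) :
  c m < 0 -> 0 <= c (m + d)%nat ->
  exists v, (m < v)%nat /\ 0 <= c v /\ forall n, (m <= n < v)%nat -> c n < 0.
Proof.
  revert m. induction d as [|d IH]; intros m Hm Hd.
  - rewrite Nat.add_0_r in Hd. lra.
  - destruct (Rlt_le_dec (c (S m)) 0) as [Hc|Hc].
    + destruct (IH (S m) Hc) as (v & Hv & Hcv & H);
        [now rewrite Nat.add_succ_comm|].
      exists v. split; [lia|split; [easy|]]. intros n Hn.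
      destruct (Nat.eq_dec n m) as [->|]; [easy|]. apply H. lia.
    + exists (S m). split; [lia|split; [easy|]]. intros n Hn.
      now replace n with m by lia.
Qed.

(** The index [u] is the last one before [m] with a nonnegative coefficient and
    [v] the first one after [m].  The ratio falls when leaving [u], hence it fell
    all the way to [u]; it rises when reaching [v], hence it rises ever after. *)
Lemma excess_sign_pattern (p lam : R) (m : nat) :
  0 < p < 1 -> excess p lam m < 0 ->
  exists u v, (u < m < v)%nat /\
    (forall n, (n <= u)%nat -> 0 <= excess p lam n) /\
    (forall n, (u < n < v)%nat -> excess p lam n <= 0) /\
    (forall n, (v <= n)%nat -> 0 <= excess p lam n).
Proof.
  intros [Hp Hp1] Hm.
  destruct (last_nonneg_before (excess p lam) m) as (u & Hu & Hcu & Hbelow);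
    [rewrite excess_0; lra|easy|].
  destruct (excess_eventually_pos p lam (conj Hp Hp1)) as [N HN].
  destruct (first_nonneg_after (excess p lam) m N Hm) as (v & Hv & Hcv & Habove);
    [apply Rlt_le, HN; lia|].
  exists u, v. split; [lia|split; [|split]].
  - intros n Hn.
    destruct u as [|u]; [now replace n with O by lia|].
    (* The ratio drops below [lam] right after [S u]. *)
    assert (Hru : lam <= coef_ratio p (S u)).
    { apply Rnot_lt_le. intros H. apply (excess_neg_iff p lam u Hp) in H. lra. }
    assert (Hru' : coef_ratio p (S (S u)) < lam)
      by (apply excess_neg_iff; [easy|]; apply Hbelow; lia).
    apply excess_nonneg; [easy|].
    apply Rle_trans with (1 := Hru), coef_ratio_fell_before; [easy|lra|easy].
  - intros n Hn. apply Rlt_le.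
    destruct (Nat.le_gt_cases n m); [apply Hbelow|apply Habove]; lia.
  - intros n Hn.
    destruct v as [|[|v]]; [lia|lia|].
    (* The ratio climbs back to [lam] on reaching [S (S v)]. *)
    assert (Hrv : lam <= coef_ratio p (S (S v))).
    { apply Rnot_lt_le. intros H. apply excess_neg_iff in H; [lra|easy]. }
    assert (Hrv' : coef_ratio p (S v) < lam)
      by (apply excess_neg_iff; [easy|]; apply Habove; lia).
    apply excess_nonneg; [easy|].
    apply Rle_trans with (1 := Hrv), coef_ratio_rises_forever; [easy|lra|easy].
Qed.

(** A negative coefficient exists, since otherwise the series could not vanish at
    [s]; around it the signs are [+ - +]. *)
Lemma excess_pos_of_double_zero (p lam s x : R) :
  0 < p < 1 -> 0 < s ->
  PSeries (excess p lam) s = 0 -> PSeries (PS_derive (excess p lam)) s = 0 ->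
  0 < x -> x <> s -> 0 < PSeries (excess p lam) x.
Proof.
  intros Hp Hs Hf Hf' Hx Hxs.
  assert (Hneg : exists m, excess p lam m < 0).
  { apply NNPP. intros Hno.
    destruct (excess_eventually_pos p lam Hp) as [N HN].
    assert (0 < PSeries (excess p lam) s); [|lra].
    apply PSeries_pos with N; [| |apply HN; lia|easy].
    - apply CV_radius_inside. now rewrite CV_radius_excess.
    - intros n. apply Rnot_lt_le. intros H. apply Hno. now exists n. }
  destruct Hneg as [m Hm].
  destruct (excess_sign_pattern p lam m Hp Hm) as (u & v & Huv & H1 & H2 & H3).
  apply PSeries_pos_of_double_zero with u m v s; auto.
  now apply CV_radius_excess.
Qed.

(** * The ratio of the two functions *)

Lemma cosh_minus_1_pos (p t : R) : 0 < p -> 0 < t -> 0 < cosh (p * t) - 1.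
Proof.
  intros Hp Ht. rewrite cosh_minus_1 by easy.
  apply PSeries_pos with 1%nat; [| | |now apply pow_lt].
  - apply CV_radius_inside. now rewrite CV_radius_cosh_coef.
  - intros n. now apply cosh_coef_nonneg.
  - now apply cosh_coef_pos.
Qed.

Lemma PSeries_excess_ratio (p lam t : R) : 0 < p -> 0 < t ->
  PSeries (excess p lam) (t ^ 2)
  = (bessel_cosh_ratio p t - lam) * (cosh (p * t) - 1).
Proof.
  intros Hp Ht. rewrite PSeries_excess_sq by easy. unfold bessel_cosh_ratio.
  pose proof (cosh_minus_1_pos p t Hp Ht). field. lra.
Qed.

Lemma lt_ratio_iff (p lam t : R) : 0 < p -> 0 < t ->
  (lam < bessel_cosh_ratio p t <-> 0 < PSeries (excess p lam) (t ^ 2)).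
Proof.
  intros Hp Ht. rewrite PSeries_excess_ratio by easy.
  pose proof (cosh_minus_1_pos p t Hp Ht). split; intros; nra.
Qed.

Lemma ratio_lt_iff (p lam t : R) : 0 < p -> 0 < t ->
  (bessel_cosh_ratio p t < lam <-> PSeries (excess p lam) (t ^ 2) < 0).
Proof.
  intros Hp Ht. rewrite PSeries_excess_ratio by easy.
  pose proof (cosh_minus_1_pos p t Hp Ht). split; intros; nra.
Qed.

Lemma is_derive_sq (t : R) : is_derive (fun t => t ^ 2) t (2 * t).
Proof. auto_derive; [easy|ring]. Qed.

Lemma ex_derive_cosh (p t : R) : ex_derive (fun t => cosh (p * t) - 1) t.
Proof. unfold cosh. auto_derive; easy. Qed.

Lemma ex_derive_ratio (p t : R) : 0 < p -> 0 < t ->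
  ex_derive (bessel_cosh_ratio p) t.
Proof.
  intros Hp Ht. unfold bessel_cosh_ratio. apply ex_derive_div.
  - apply ex_derive_ext with (fun t => PSeries bessel_coef (t ^ 2)).
    { intros y. now rewrite BesselI0_minus_1. }
    apply (ex_derive_comp (PSeries bessel_coef) (fun t => t ^ 2)).
    + apply ex_derive_PSeries. now rewrite CV_radius_bessel_coef.
    + eexists. apply is_derive_sq.
  - apply ex_derive_cosh.
  - pose proof (cosh_minus_1_pos p t Hp Ht). lra.
Qed.

(** Near [s] the excess is [(h t - h s) * (cosh (p t) - 1)], a product whose
    first factor vanishes at [s] together with its derivative. *)
Lemma critical_point_double_zero (p s : R) : 0 < p -> 0 < s ->
  is_derive (bessel_cosh_ratio p) s 0 ->
  PSeries (excess p (bessel_cosh_ratio p s)) (s ^ 2) = 0 /\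
  PSeries (PS_derive (excess p (bessel_cosh_ratio p s))) (s ^ 2) = 0.
Proof.
  intros Hp Hs Hd. set (lam := bessel_cosh_ratio p s).
  split; [rewrite PSeries_excess_ratio by easy; fold lam; ring|].
  set (D := PSeries (PS_derive (excess p lam)) (s ^ 2)).
  assert (H1 : is_derive (fun t => PSeries (excess p lam) (t ^ 2)) s (2 * s * D)).
  { apply (is_derive_comp (PSeries (excess p lam)) (fun t => t ^ 2)).
    - apply is_derive_PSeries. now rewrite CV_radius_excess.
    - apply is_derive_sq. }
  assert (H2 : is_derive (fun t => PSeries (excess p lam) (t ^ 2)) s 0).
  { destruct (ex_derive_cosh p s) as [l Hl].
    apply is_derive_ext_loc with
      (fun t => (bessel_cosh_ratio p t - lam) * (cosh (p * t) - 1)).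
    - exists (mkposreal s Hs). intros t Ht.
      apply Rabs_def2 in Ht. simpl in Ht. symmetry. apply PSeries_excess_ratio; [easy|].
      unfold minus, plus, opp in Ht; simpl in Ht. lra.
    - replace 0 with ((0 - 0) * (cosh (p * s) - 1)
                      + (bessel_cosh_ratio p s - lam) * l)
        by (unfold lam; ring).
      apply (is_derive_mult (fun t => bessel_cosh_ratio p t - lam)
               (fun t => cosh (p * t) - 1)); [|easy|apply Rmult_comm].
      apply (is_derive_minus (bessel_cosh_ratio p) (fun _ => lam)); [easy|].
      apply (is_derive_const lam). }
  pose proof (is_derive_unique _ _ _ H1) as E.
  rewrite (is_derive_unique _ _ _ H2) in E.
  symmetry in E. apply Rmult_integral in E. destruct E; lra.
Qed.

Lemma ratio_critical_is_strict_min (p s t : R) : 0 < p < 1 ->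
  0 < s -> is_derive (bessel_cosh_ratio p) s 0 ->
  0 < t -> t <> s -> bessel_cosh_ratio p s < bessel_cosh_ratio p t.
Proof.
  intros Hp Hs Hd Ht Hts.
  destruct (critical_point_double_zero p s (proj1 Hp) Hs Hd) as [Hf Hf'].
  apply lt_ratio_iff; [easy|easy|].
  apply excess_pos_of_double_zero with (s ^ 2); try easy; try now apply pow_lt.
  intros E. apply Hts. nra.
Qed.

(** For [lam = 1 / (2 p^2)] the coefficients of [x^0] and [x^1] vanish and that
    of [x^2] is negative. *)
Lemma ratio_below_initial_value (p : R) : 0 < p -> 3 < 4 * p ^ 2 ->
  exists t, 0 < t /\ bessel_cosh_ratio p t < 1 / (2 * p ^ 2).
Proof.
  intros Hp H3. set (lam := 1 / (2 * p ^ 2)).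
  assert (Hlam : coef_ratio p 1 = lam) by now apply coef_ratio_1.
  destruct (PSeries_pos_near_0 (PS_opp (excess p lam)) 2 1) as (x & Hx & Hpos).
  - rewrite CV_radius_opp. now apply CV_radius_excess.
  - intros [|[|n]] Hn; [| |lia]; unfold PS_opp, opp; simpl.
    + rewrite excess_0. ring.
    + rewrite excess_factor, Hlam by easy. ring.
  - unfold PS_opp, opp; simpl.
    apply Ropp_0_gt_lt_contravar, excess_neg_iff; [easy|].
    apply Rnot_le_lt. rewrite <- Hlam. rewrite coef_ratio_le_succ by easy.
    simpl (INR 1). lra.
  - lra.
  - rewrite PSeries_opp in Hpos. exists (sqrt x).
    assert (Hs : 0 < sqrt x) by (apply sqrt_lt_R0; lra).
    split; [easy|]. apply ratio_lt_iff; [easy|easy|].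
    rewrite pow2_sqrt; lra.
Qed.

Lemma ratio_large_near_infinity (p lam T : R) : 0 < p < 1 -> 0 < T ->
  exists t, T < t /\ lam < bessel_cosh_ratio p t.
Proof.
  intros Hp HT. destruct (excess_eventually_pos p lam Hp) as [N HN].
  destruct (PSeries_pos_at_infinity (excess p lam) N) as (X & HX & Hpos);
    [now apply CV_radius_excess|easy|].
  assert (Hs : T < sqrt (X + T ^ 2)).
  { rewrite <- (sqrt_pow2 T) at 1 by lra.
    apply sqrt_lt_1; pose proof (pow2_ge_0 T); lra. }
  exists (sqrt (X + T ^ 2)). split; [easy|].
  apply lt_ratio_iff; [easy|lra|].
  pose proof (pow2_ge_0 T). rewrite pow2_sqrt by lra. apply Hpos. lra.
Qed.

Lemma ratio_large_near_0 (p lam T : R) : 0 < p -> lam < 1 / (2 * p ^ 2) ->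
  0 < T -> exists t, 0 < t < T /\ lam < bessel_cosh_ratio p t.
Proof.
  intros Hp Hlam HT.
  destruct (PSeries_pos_near_0 (excess p lam) 1 (T ^ 2)) as (x & Hx & Hpos).
  - now apply CV_radius_excess.
  - intros n Hn. replace n with O by lia. apply excess_0.
  - apply excess_pos_iff; [easy|]. now rewrite coef_ratio_1.
  - now apply pow_lt.
  - exists (sqrt x).
    assert (Hs : 0 < sqrt x) by (apply sqrt_lt_R0; lra).
    split; [split; [easy|]|].
    + rewrite <- (sqrt_pow2 T) by lra. apply sqrt_lt_1; lra.
    + apply lt_ratio_iff; [easy|easy|]. rewrite pow2_sqrt; lra.
Qed.

(** Some value [h t1] lies below the initial value [1 / (2 p^2)], while [h]
    exceeds [h t1] at points [a < t1] and [b > t1]; the minimum of [h] on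
    [[a, b]] is therefore interior. *)
Lemma ratio_critical_point_exists (p : R) : 0 < p < 1 -> 3 < 4 * p ^ 2 ->
  exists t0, 0 < t0 /\ is_derive (bessel_cosh_ratio p) t0 0.
Proof.
  intros Hp H3.
  destruct (ratio_below_initial_value p (proj1 Hp) H3) as (t1 & Ht1 & Hlow).
  set (lam := bessel_cosh_ratio p t1) in *.
  destruct (ratio_large_near_0 p lam t1 (proj1 Hp) Hlow Ht1) as (a & Ha & Hra).
  destruct (ratio_large_near_infinity p lam t1 Hp Ht1) as (b & Hb & Hrb).
  assert (Hder : forall t, 0 < t -> derivable_pt (bessel_cosh_ratio p) t)
    by (intros; now apply ex_derive_Reals_0, ex_derive_ratio).
  destruct (continuity_ab_min (bessel_cosh_ratio p) a b) as (t0 & Hmin & Ht0).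
  - lra.
  - intros c Hc. apply derivable_continuous_pt, Hder. lra.
  - assert (Hle : bessel_cosh_ratio p t0 <= lam) by (apply Hmin; lra).
    assert (Ha0 : a <> t0) by (intros ->; lra).
    assert (Hb0 : t0 <> b) by (intros ->; lra).
    assert (Hpos : 0 < t0) by lra.
    exists t0. split; [easy|].
    pose proof (deriv_minimum (bessel_cosh_ratio p) a b t0 (Hder t0 Hpos)) as E.
    rewrite <- E; [|lra|lra|intros; apply Hmin; lra].
    apply is_derive_Reals, derive_pt_eq_1 with (Hder t0 Hpos). reflexivity.
Qed.

(** The coefficient ratio is nondecreasing from [n = 1] on.  If [4 p^2 = 3] its
    first two values agree, so strictness comes from the third. *)
Lemma ratio_gt_initial_value (p t : R) : 0 < p -> 4 * p ^ 2 <= 3 -> 0 < t ->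
  1 / (2 * p ^ 2) < bessel_cosh_ratio p t.
Proof.
  intros Hp H3 Ht. apply lt_ratio_iff; [easy|easy|].
  rewrite <- coef_ratio_1 by easy.
  assert (H12 : coef_ratio p 1 <= coef_ratio p 2)
    by (apply coef_ratio_le_succ; [easy|]; simpl (INR 1); lra).
  apply PSeries_pos with 3%nat; [| | |now apply pow_lt].
  - apply CV_radius_inside. now rewrite CV_radius_excess.
  - intros [|[|n]].
    + rewrite excess_0. lra.
    + apply excess_nonneg; [easy|lra].
    + apply excess_nonneg; [easy|]. apply Rle_trans with (1 := H12).
      apply coef_ratio_rises_forever; [easy|easy|lia].
  - apply excess_pos_iff; [easy|]. apply Rle_lt_trans with (1 := H12).
    apply Rnot_le_lt. rewrite coef_ratio_ge_succ by easy. simpl (INR 2). lra.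
Qed.

(** Each step of the coefficient ratio is a strict decrease, as
    [(2n+1)/(2n+2) < 1 <= q^2]. *)
Lemma ratio_lt_initial_value (q t : R) : 1 <= q -> 0 < t ->
  bessel_cosh_ratio q t < 1 / (2 * q ^ 2).
Proof.
  intros Hq1 Ht. assert (Hq : 0 < q) by lra.
  assert (Hq2 : 1 <= q ^ 2) by (apply pow_R1_Rle; lra).
  apply ratio_lt_iff; [easy|easy|].
  rewrite <- coef_ratio_1 by easy.
  assert (Hdec : forall n, coef_ratio q (S n) < coef_ratio q n).
  { intros n. apply Rnot_le_lt. rewrite coef_ratio_le_succ by easy.
    pose proof (pos_INR n). nra. }
  apply Ropp_lt_cancel. rewrite Ropp_0, <- PSeries_opp.
  apply PSeries_pos with 2%nat; [| | |now apply pow_lt].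
  - apply CV_radius_inside. now rewrite CV_radius_opp, CV_radius_excess.
  - intros n. apply Ropp_0_ge_le_contravar, Rle_ge.
    destruct n as [|n]; [rewrite excess_0; lra|].
    rewrite excess_factor by easy.
    assert (coef_ratio q (S n) <= coef_ratio q 1)
      by (apply coef_ratio_fell_before; [easy|apply Hdec|lia]).
    pose proof (cosh_coef_pos q n Hq). nra.
  - apply Ropp_0_gt_lt_contravar, excess_neg_iff; [easy|apply Hdec].
Qed.

Lemma le_half_sqrt_3_iff (p : R) : 0 < p -> (p <= sqrt 3 / 2 <-> 4 * p ^ 2 <= 3).
Proof.
  intros Hp. pose proof (sqrt_pos 3). pose proof (sqrt_def 3 ltac:(lra)).
  split; intros; nra.
Qed.

(** * The two parts of the theorem *)

Theorem theorem5 :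
  (forall p q : R, 0 < p -> 0 < q ->
     ((forall t : R, 0 < t ->
         1 - 1 / (2 * p ^ 2) + 1 / (2 * p ^ 2) * cosh (p * t) < BesselI0 t /\
         BesselI0 t < 1 - 1 / (2 * q ^ 2) + 1 / (2 * q ^ 2) * cosh (q * t))
      <-> (p <= sqrt 3 / 2 /\ 1 <= q)))
  /\
  (forall p : R, sqrt 3 / 2 < p -> p < 1 ->
     exists t0 : R,
       unique (fun s : R => 0 < s /\ is_derive (bessel_cosh_ratio p) s 0) t0 /\
       forall t : R, 0 < t ->
         BesselI0 t >=
           1 - lambda0 p t0 / p ^ 2 + lambda0 p t0 / p ^ 2 * cosh (p * t)).
Proof.
  split.
  - intros p q Hp Hq. rewrite le_half_sqrt_3_iff by easy.
    assert (Hlower : forall t, 0 < t ->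
      (1 - 1 / (2 * p ^ 2) + 1 / (2 * p ^ 2) * cosh (p * t) < BesselI0 t
       <-> 1 / (2 * p ^ 2) < bessel_cosh_ratio p t)).
    { intros t Ht. rewrite lt_ratio_iff, PSeries_excess_sq by easy.
      split; intros; lra. }
    assert (Hupper : forall t, 0 < t ->
      (BesselI0 t < 1 - 1 / (2 * q ^ 2) + 1 / (2 * q ^ 2) * cosh (q * t)
       <-> bessel_cosh_ratio q t < 1 / (2 * q ^ 2))).
    { intros t Ht. rewrite ratio_lt_iff, PSeries_excess_sq by easy.
      split; intros; lra. }
    split.
    + intros H. split; apply Rnot_lt_le; intros Hlt.
      * destruct (ratio_below_initial_value p Hp Hlt) as (t & Ht & Hr).
        destruct (H t Ht) as [Hl _]. apply Hlower in Hl; [lra|easy].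
      * destruct (ratio_large_near_infinity q (1 / (2 * q ^ 2)) 1) as (t & Ht & Hr);
          [lra|lra|].
        assert (Ht0 : 0 < t) by lra.
        destruct (H t Ht0) as [_ Hu]. apply Hupper in Hu; [lra|easy].
    + intros [Hp3 Hq1] t Ht. split.
      * now apply Hlower, ratio_gt_initial_value.
      * now apply Hupper, ratio_lt_initial_value.
  - intros p Hp3 Hp1.
    assert (Hp : 0 < p) by (pose proof (sqrt_pos 3); lra).
    assert (H3 : 3 < 4 * p ^ 2).
    { apply Rnot_le_lt. rewrite <- le_half_sqrt_3_iff by easy. lra. }
    destruct (ratio_critical_point_exists p (conj Hp Hp1) H3) as (t0 & Ht0 & Hd0).
    exists t0. split; [split; [easy|]|].
    + intros s [Hs Hds].
      destruct (Req_dec t0 s) as [|Hne]; [easy|exfalso].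
      pose proof (ratio_critical_is_strict_min p t0 s (conj Hp Hp1) Ht0 Hd0 Hs
                    (not_eq_sym Hne)).
      pose proof (ratio_critical_is_strict_min p s t0 (conj Hp Hp1) Hs Hds Ht0 Hne).
      lra.
    + intros t Ht.
      replace (lambda0 p t0 / p ^ 2) with (bessel_cosh_ratio p t0).
      2: { pose proof (cosh_minus_1_pos p t0 Hp Ht0).
           unfold lambda0, bessel_cosh_ratio. field. lra. }
      assert (Hmin : bessel_cosh_ratio p t0 <= bessel_cosh_ratio p t).
      { destruct (Req_dec t t0) as [->|Hne]; [lra|].
        now apply Rlt_le, ratio_critical_is_strict_min. }
      pose proof (cosh_minus_1_pos p t Hp Ht) as Hc.
      pose proof (PSeries_excess_ratio p (bessel_cosh_ratio p t0) t Hp Ht) as E.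
      rewrite PSeries_excess_sq in E by easy. nra.
Qed.
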